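(* Let $\beta\in\mathbb R$ and let $\varphi:\mathbb R^n\to\mathbb R^n$ be a homeomorphism. Then for every cube $Q\subset\mathbb R^n$, $$\|\varphi\|_{\mathscr G_\beta(Q)}=\sup_{\{\mu_J\}\in\mathscr T^*_\beta(Q)}\ \sum_{J\in\mathcal D(Q)}\mu_J\left(\frac{|J|}{|Q|}\right)^\beta,$$ where $$\mathscr T_\beta^*(Q):=\left\{\{\mu_J\}_{J\in\mathcal D(Q)}\subset[0,\infty):\ \sum_{J\in\mathcal D(Q),\,J\subset I}\mu_J\left(\frac{|\varphi^{-1}(J)|}{|\varphi^{-1}(I)|}\right)^\beta\le1\ \text{ for all }I\in\mathcal D(Q)\right\}.$$
   Context: All cubes in $\mathbb R^n$ have sides parallel to the coordinate axes (open, closed or half-open); $\ell(Q)$ is the side length, $|E|$ is Lebesgue measure. For a cube $Q$, $\mathcal D_0(Q)=\{Q\}$, and for $k\in\mathbb N$, $\mathcal D_k(Q)$ is the family of the $2^{kn}$ subcubes of side length $2^{-k}\ell(Q)$ obtained by $k$ successive bisections of each side of $Q$; $\mathcal D(Q)=\bigcup_{k\ge0}\mathcal D_k(Q)$. For a cube $Q$, let $\mathscr T_\beta(Q)$ be the set of families $\{\lambda_I\}_{I\in\mathcal D(Q)}\subset[0,\infty)$ with $$\sum_{I\in\mathcal D(Q),\,I\supset J}\lambda_I\left(\frac{|I|}{|J|}\cdot\frac{|\varphi^{-1}(J)|}{|\varphi^{-1}(I)|}\right)^\beta\ge1\quad\text{for all }J\in\mathcal D(Q),$$ and $$\|\varphi\|_{\mathscr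 G_\beta(Q)}:=\inf_{\{\lambda_I\}\in\mathscr T_\beta(Q)}\sum_{I\in\mathcal D(Q)}\lambda_I\left(\frac{|I|}{|Q|}\right)^\beta\in[0,\infty].$$ (Since $\varphi$ is a homeomorphism, $0<|\varphi^{-1}(I)|<\infty$ for every cube $I$.) *)

(* Defs.v *)
From HB Require Import structures.
From mathcomp Require Import all_boot all_order all_algebra.
From mathcomp Require Import all_classical all_reals all_analysis.
Import Order.TTheory GRing.Theory Num.Theory.
Import numFieldNormedType.Exports.

Set Implicit Arguments.
Unset Strict Implicit.
Unset Printing Implicit Defensive.

Local Open Scope classical_set_scope.
Local Open Scope ring_scope.

Definition homeomorphism (T U : topologicalType) (f : T -> U) : Prop :=
  exists g : U -> T, [/\ cancel f g, cancel g f, continuous f & continuous g].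

Definition box (R : realType) (n : nat) (a b : 'rV[R]_n) : set 'rV[R]_n :=
  [set x | forall i, a 0 i <= x 0 i <= b 0 i].

(* Lebesgue (outer) measure on R^n: the infimum of the total volume over
   countable covers by closed boxes. It is the Lebesgue measure on measurable
   sets; below it is only evaluated at cubes and at their preimages under a
   continuous map, which are Borel sets. *)
Definition lebesgue_rV (R : realType) (n : nat) (A : set 'rV[R]_n) : \bar R :=
  ereal_inf [set s | exists a b : nat -> 'rV[R]_n,
    [/\ forall k i, a k 0 i <= b k 0 i,
        A `<=` \bigcup_k box (a k) (b k) &
        s = (\sum_(0 <= k <oo) (\prod_i (b k 0 i - a k 0 i))%:E)%E]].

(* Real-valued; meaningful for sets of finite measure. *)
Definition vol (R : realType) (n : nat) (A : set 'rV[R]_n) : R :=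
  fine (lebesgue_rV A).

(* The two booleans tell whether the lower and upper endpoints of every side
   are included: they cover open, closed and (both kinds of) half-open cubes. *)
Record cube (R : realType) (n : nat) := Cube {
  corner : 'rV[R]_n;
  side : R;
  lower_closed : bool;
  upper_closed : bool;
  side_gt0 : 0 < side }.

HB.instance Definition _ (R : realType) (n : nat) := gen_eqMixin (cube R n).
HB.instance Definition _ (R : realType) (n : nat) := gen_choiceMixin (cube R n).

(* [BSide true] is a closed lower bound, but an open upper bound. *)
Definition cube_set (R : realType) (n : nat) (Q : cube R n) : set 'rV[R]_n :=
  [set x | forall i, x 0 i \in
     Interval (BSide (lower_closed Q) (corner Q 0 i))
              (BSide (~~ upper_closed Q) (corner Q 0 i + side Q))].
Coercion cube_set : cube >-> set.

(* Bisecting each side of Q gives 2^n subcubes, of the same kind as Q; [e i]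
   selects the upper half of the i-th side. *)
Definition subcube (R : realType) (n : nat) (Q : cube R n) (e : 'I_n -> bool) :
    cube R n :=
  Cube (corner Q + (side Q / 2) *: \row_i (e i)%:R)
       (lower_closed Q) (upper_closed Q)
       (divr_gt0 (side_gt0 Q) (ltr0Sn R 1)).

Fixpoint dyadic_gen (R : realType) (n : nat) (k : nat) (Q : cube R n) :
    set (cube R n) :=
  if k is k'.+1 then \bigcup_(I in dyadic_gen k' Q) range (subcube I)
  else [set Q].

Definition dyadic (R : realType) (n : nat) (Q : cube R n) : set (cube R n) :=
  \bigcup_k dyadic_gen k Q.

(* Families indexed by [dyadic Q] are represented by functions on all cubes,
   whose values outside [dyadic Q] are irrelevant. *)
Definition T_family (R : realType) (n : nat) (phi : 'rV[R]_n -> 'rV[R]_n)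
    (beta : R) (Q : cube R n) : set (cube R n -> R) :=
  [set lam | (forall I, dyadic Q I -> 0 <= lam I) /\
    (forall J : cube R n, dyadic Q J ->
      (1 <= \esum_(I in [set I : cube R n | dyadic Q I /\ J `<=` I])
        (lam I * ((vol I / vol J) *
                  (vol (phi @^-1` J) / vol (phi @^-1` I))) `^ beta)%:E)%E)].

Definition G_norm (R : realType) (n : nat) (phi : 'rV[R]_n -> 'rV[R]_n)
    (beta : R) (Q : cube R n) : \bar R :=
  ereal_inf [set (\esum_(I in dyadic Q)
                    (lam I * (vol I / vol Q) `^ beta)%:E)%E
            | lam in T_family phi beta Q].

Definition Tstar_family (R : realType) (n : nat) (phi : 'rV[R]_n -> 'rV[R]_n)
    (beta : R) (Q : cube R n) : set (cube R n -> R) :=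
  [set mu | (forall J, dyadic Q J -> 0 <= mu J) /\
    (forall I : cube R n, dyadic Q I ->
      (\esum_(J in [set J : cube R n | dyadic Q J /\ J `<=` I])
        (mu J * (vol (phi @^-1` J) / vol (phi @^-1` I)) `^ beta)%:E <= 1)%E)].

(* Main.v *)
Require Import Defs.
From HB Require Import structures.
From mathcomp Require Import all_boot all_order all_algebra.
From mathcomp Require Import finmap ring lra.
From mathcomp Require Import all_classical all_reals all_analysis.
From mathcomp Require Import measurable_realfun.
Import Order.TTheory GRing.Theory Num.Theory.
Import numFieldNormedType.Exports.

Set Implicit Arguments.
Unset Strict Implicit.
Unset Printing Implicit Defensive.

Local Open Scope classical_set_scope.
Local Open Scope ring_scope.

(* The two sides are dual linear programs on the tree of dyadic subcubes: with
   [u I = (|I| / |phi^-1 I|)^beta], [q I = |phi^-1 I|^beta], [x I = lam I * u I]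
   and [y J = mu J * q J], one minimises [\sum_I x I * q I] subject to
   [u J <= \sum_(I above J) x I], or maximises [\sum_J y J * u J] subject to
   [\sum_(J below I) y J <= q I].  Weak duality is an exchange of sums, finite
   because a cube has finitely many ancestors.  On the cubes of generation at
   most [N] there is no duality gap: a greedy filling in decreasing order of [u]
   yields an optimal [y], and the constraints it saturates yield an optimal [x].
   These finite [x] are bounded at each cube, so they converge along an
   ultrafilter on [N]; the limit is feasible since ancestor sums are finite, and
   its cost is at most the dual value by Fatou.  The values of [u] and [q] enter
   only through their positivity, that is through [0 < |phi^-1 I| < oo]. *)

(** * Linear programming duality on a finite tree *)

Lemma seq_argmin (T : eqType) (R : realDomainType) (f : T -> R) (s : seq T) :
  s != [::] -> exists2 x, x \in s & forall y, y \in s -> f x <= f y.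
Proof.
elim: s => // a [|b s] IH _.
  by exists a; rewrite ?mem_head// => y /[!inE] /eqP ->.
have [//|x xs xmin] := IH.
have [ax|xa] := lerP (f a) (f x).
- exists a; rewrite ?mem_head// => y; rewrite in_cons => /predU1P[->//|ys].
  by rewrite (le_trans ax)// xmin.
- exists x; rewrite ?(in_cons a) ?xs ?orbT// => y.
  rewrite in_cons => /predU1P[->|ys]; first exact: ltW.
  exact: xmin.
Qed.

Section finite_duality.
Context {T : eqType} {R : realFieldType} (r : rel T).
Hypotheses (rxx : reflexive r) (rA : antisymmetric r) (rT : transitive r).
Hypothesis r_chain : forall J I I', r J I -> r J I' -> r I I' || r I' I.
Variables (V : seq T) (m w : T -> R).
Hypotheses (V_uniq : uniq V) (m_gt0 : forall I, I \in V -> 0 < m I).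
Hypothesis w_ge0 : forall J, J \in V -> 0 <= w J.

Let load (y : T -> R) I := \sum_(J <- V | r J I) y J.

(* The nodes are processed by decreasing [w], and each takes as much mass as the
   constraints of its ancestors allow.  [s I] is the value of [w] at which the
   constraint at [I] became tight, and 0 if it is not tight. *)
Lemma greedy_filling (p : seq T) : uniq p -> {subset p <= V} ->
    pairwise (fun J J' => w J <= w J') p ->
  exists y s : T -> R,
  [/\ (forall J, 0 <= y J) /\ (forall J, J \notin p -> y J = 0),
      (forall I, 0 <= s I) /\ (forall I, I \in V -> load y I < m I -> s I = 0),
      forall I, I \in V -> load y I <= m I /\
        (load y I = m I -> exists2 J, J \in p & w J <= s I),
      forall J, J \in p -> exists2 I, I \in V & r J I && (w J <= s I) &
      forall J, 0 < y J -> forall I, I \in V -> r J I -> s I <= w J].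
Proof.
(* The list [p] increases in [w], so the tail, with the larger values, is filled before the head
   [a]. *)
elim: p => [_ _ _|a p IH /= /andP[ap p_uniq] apV /andP[/allP /= wa wp]].
  exists (fun=> 0), (fun=> 0); split => //.
  - move=> I IV; rewrite /load big1// (ltW (m_gt0 IV)); split => // m0.
    by have := m_gt0 IV; rewrite -m0 ltxx.
  - by move=> J; rewrite ltxx.
have aV : a \in V by apply: apV; rewrite mem_head.
have pV : {subset p <= V} by move=> J Jp; apply: apV; rewrite inE Jp orbT.
have [y [s [[y0 yp] [s0 sN] yV sp sy]]] := IH p_uniq pV wp.
(* If an ancestor [I] of [a] is already tight, [a] gets no mass: [I] became tight at a value
   [s I >= w J'] with [J'] in [p], hence at least [w a]. *)
have [/hasP[I IV /andP[raI /eqP tI]]|/hasPn nt] :=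
  boolP (has (fun I => r a I && (load y I == m I)) V).
  exists y, s; split=> //.
  - by split=> // J; rewrite inE negb_or => /andP[_ /yp].
  - move=> I' I'V; have [? h] := yV _ I'V; split => // /h[J Jp wJ].
    by exists J; rewrite ?inE ?Jp ?orbT.
  - move=> J /[!inE] /predU1P[->|]; last exact: sp.
    exists I => //; rewrite raI.
    have [_ /(_ tI)[J' J'p wJ']] := yV _ IV.
    by rewrite (le_trans (wa _ J'p)).
have ne : [seq I <- V | r a I] != [::].
  apply/eqP => e; have : a \in [seq I <- V | r a I] by rewrite mem_filter rxx.
  by rewrite e.
(* Otherwise [a] takes the least slack [d] among its ancestors, which makes [I0] tight and overloads
   none of them. *)
have [I0] := seq_argmin (fun I => m I - load y I) ne.
rewrite mem_filter => /andP[raI0 I0V] I0min.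
set d := m I0 - load y I0 in I0min.
have d_gt0 : 0 < d.
  have := nt _ I0V; rewrite raI0/= => nI0.
  by rewrite subr_gt0 lt_neqAle nI0 (yV _ I0V).1.
pose y' J := if J == a then d else y J.
have load_y' I : I \in V -> load y' I = load y I + (if r a I then d else 0).
  move=> IV; rewrite /load.
  rewrite (eq_bigr (fun J => y J + if J == a then d else 0)); last first.
    by move=> J _; rewrite /y'; case: eqP => [->|_]; rewrite ?(yp a)// ?add0r ?addr0.
  rewrite big_split/=; congr (_ + _); rewrite -big_mkcondr/= big_mkcond.
  rewrite (bigD1_seq a)//= eqxx andbT big1 ?addr0// => J /negbTE ->.
  by rewrite andbF.
(* All ancestors of [a] were slack, so [s] was 0 there; those that become tight now receive [w a],
   which is at most every value of [w] on [p]. *)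
pose s' I := if r a I && (load y' I == m I) then w a else s I.
have w0 := w_ge0 aV.
have sa I : I \in V -> r a I -> s I = 0.
  move=> IV raI; apply: sN => //.
  by have := nt _ IV; rewrite raI/= lt_neqAle => ->; exact: (yV _ IV).1.
exists y', s'; split.
- split=> J; rewrite /y'; first by case: eqP => // _; exact: ltW.
  by rewrite inE negb_or => /andP[/negbTE -> /yp].
- split=> I; rewrite /s'; first by case: ifP.
  move=> IV /[dup] lI /lt_eqF ->; rewrite andbF; apply: sN => //.
  apply: le_lt_trans lI; rewrite load_y'//; case: ifP => _; rewrite ?addr0//.
  by rewrite lerDl ltW.
- move=> I IV; have [yI yI'] := yV _ IV; rewrite /s' load_y'//.
  case: ifPn => raI; last first.
    by rewrite addr0/=; split=> // /yI'[J Jp wJ]; exists J; rewrite ?inE ?Jp ?orbT.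
  split; first by rewrite -lerBrDl I0min// mem_filter raI.
  by move=> ->; rewrite eqxx; exists a; rewrite ?mem_head.
- move=> J /[!inE] /predU1P[->|/[dup] Jp /sp[I IV /andP[rJI wJ]]].
    by exists I0; rewrite // raI0 /s' load_y'// raI0 /d addrC subrK eqxx/= lexx.
  exists I => //; rewrite rJI /s'; case: ifP => // /andP[raI _].
  by rewrite (le_trans wJ)// sa.
- move=> J; rewrite /y'; case: eqP => [->|Ja] yJ I IV rI; rewrite /s'.
    by case: ifP => // _; rewrite sa.
  case: ifP => _; last exact: sy.
  by apply: wa; apply: contraLR yJ => /yp ->; rewrite ltxx.
Qed.

Let above (s : T -> R) (P : pred T) := \big[Num.max/0]_(I <- V | P I) s I.

(** Along an ascending chain, the maximum over the strict ancestors of a node is the maximum from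
    the next node upward, and the default 0 at the top; the increments therefore telescope. *)
Lemma telescope_chain (s : T -> R) (c : seq T) : pairwise r c -> uniq c ->
  \sum_(I <- c) (\big[Num.max/0]_(I' <- c | r I I') s I' -
                 \big[Num.max/0]_(I' <- c | r I I' && (I' != I)) s I')
  = \big[Num.max/0]_(I' <- c) s I'.
Proof.
elim: c => [_ _|z c IH /= /andP[/allP/= zc rc] /andP[zNc c_uniq]].
  by rewrite !big_nil.
rewrite !big_cons rxx eqxx/=.
have zcE : {in c, r z =1 xpredT} by move=> I Ic; rewrite zc.
rewrite -[X in _ = Num.max _ X](IH rc c_uniq).
have -> : \big[Num.max/0]_(j <- c | r z j) s j = \big[Num.max/0]_(j <- c) s j.
  rewrite big_seq_cond [RHS]big_seq; apply: eq_bigl => j.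
  by case: (boolP (j \in c)) => //= /zc ->.
have -> : \big[Num.max/0]_(j <- c | r z j && (j != z)) s j =
    \big[Num.max/0]_(j <- c) s j.
  rewrite big_seq_cond [RHS]big_seq; apply: eq_bigl => j.
  case: (boolP (j \in c)) => //= jc.
  by rewrite zc//=; apply: contraNneq zNc => <-.
rewrite (IH rc c_uniq) [X in _ + X](_ : _ = \big[Num.max/0]_(j <- c) s j) ?subrK//.
rewrite -[RHS](IH rc c_uniq) big_seq [RHS]big_seq; apply: eq_bigr => I Ic.
have rIz : r I z = false.
  by apply: contraNF zNc => rIz; rewrite (_ : z = I)//; apply: rA; rewrite rIz zc.
by rewrite !big_cons rIz.
Qed.


(** By [r_chain] the nodes above [J] form a chain, which sorting by [r] lists in ascending order.
    This evaluates the constraint at [J] when [x] is made of the increments of the maximum of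
    [s]. *)
Lemma sum_increments (s : T -> R) J :
  \sum_(I <- V | r J I)
     (above s (r I) - above s (fun I' => r I I' && (I' != I)))
  = above s (r J).
Proof.
pose c := sort r [seq I <- V | r J I].
have c_perm : perm_eq c [seq I <- V | r J I] by rewrite perm_sort.
have cE (P : pred T) : (forall I', P I' -> r J I') ->
    above s P = \big[Num.max/0]_(I' <- c | P I') s I'.
  move=> PJ; rewrite (perm_big _ c_perm)/= big_filter_cond.
  by apply: eq_bigl => I'; case: (boolP (P I')) => [/PJ ->|]; rewrite ?andbF.
rewrite -big_filter -(perm_big _ c_perm)/= [RHS]cE//.
rewrite (_ : \big[Num.max/0]_(I' <- c | r J I') s I' =
  \big[Num.max/0]_(I' <- c) s I'); last first.
  rewrite big_seq_cond [RHS]big_seq; apply: eq_bigl => I'.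
  by rewrite (perm_mem c_perm) mem_filter; case: (r J I'); rewrite ?andbF ?andbT.
rewrite -telescope_chain.
- apply: eq_big_seq => I; rewrite (perm_mem c_perm) mem_filter => /andP[rJI _].
  have up I' : r I I' -> r J I' by exact: rT.
  by congr (_ - _); apply: cE => I'; [exact: up|move=> /andP[/up]].
- rewrite -sorted_pairwise//.
  apply: (@sort_sorted_in _ (r J)); last exact: filter_all.
  by move=> I I'; exact: r_chain.
- by rewrite sort_uniq filter_uniq.
Qed.

(** The optimal [x I] is the excess of [s I] over the maximum of [s] on the strict ancestors of [I],
    or 0 if there is no excess. Its sum above [J] is the maximum of [s] above [J]: at least [w J],
    with equality where [y J > 0]. *)
Lemma finite_tree_duality : exists x y : T -> R,
  [/\ (forall I, 0 <= x I) /\ (forall J, 0 <= y J),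
      forall J, J \in V -> w J <= \sum_(I <- V | r J I) x I,
      forall I, I \in V -> \sum_(J <- V | r J I) y J <= m I &
      \sum_(I <- V) x I * m I = \sum_(J <- V) y J * w J].
Proof.
pose p := sort (fun J J' => w J <= w J') V.
have p_uniq : uniq p by rewrite sort_uniq.
have pV : p =i V by move=> J; rewrite mem_sort.
have p_sorted : pairwise (fun J J' => w J <= w J') p.
  rewrite -sorted_pairwise; last by move=> a b c; exact: le_trans.
  by apply: sort_sorted => a b; exact: le_total.
have [|y [s [[y0 yp] [s0 sN] yV sp sy]]] := greedy_filling p_uniq _ p_sorted.
  by move=> J; rewrite pV.
have above_ge0 P : 0 <= above s P by apply: bigmax_ge_id.
pose U I := above s (fun I' => r I I' && (I' != I)).
pose x I := above s (r I) - U I.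
have SE I : I \in V -> above s (r I) = Num.max (s I) (U I).
  move=> IV; rewrite /U /above (perm_big _ (perm_to_rem IV))/= big_cons rxx.
  rewrite [in RHS](perm_big _ (perm_to_rem IV))/= big_cons eqxx andbF.
  congr Num.max; rewrite big_seq_cond [RHS]big_seq_cond; apply: eq_bigl => I'.
  by rewrite (rem_filter _ V_uniq) mem_filter/=; case: (I' =P I) => //=; rewrite andbT.
have x0 I : 0 <= x I.
  rewrite subr_ge0 /U /above [leLHS]big_seq_cond.
  apply: bigmax_le => [|I' /and3P[I'V rII' _]]; first exact: above_ge0.
  exact: le_bigmax_seq.
have S_le J : 0 < y J -> above s (r J) <= w J.
  move=> yJ; rewrite /above big_seq_cond.
  apply: bigmax_le => [|I /andP[IV rJI]]; last exact: sy.
  by apply: w_ge0; rewrite -pV; apply: contraLR yJ => /yp ->; rewrite ltxx.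
have le_S J : J \in V -> w J <= above s (r J).
  rewrite -pV => /sp[I IV /andP[rJI wJ]]; apply: le_trans wJ _.
  exact: le_bigmax_seq.
exists x, y; split=> //.
- by move=> J JV; rewrite sum_increments le_S.
- by move=> I /yV[].
(* Complementary slackness: [x I] vanishes where [load y I < m I], since [s I] is then 0, and the
   sum of [x] above [J] is exactly [w J] where [y J] is nonzero. Both costs thus equal one double
   sum. *)
transitivity (\sum_(I <- V) x I * load y I).
  apply: eq_big_seq => I IV.
  have [xI|] := eqVneq (x I) 0; first by rewrite xI !mul0r.
  have [|lI] := eqVneq (load y I) (m I); first by move=> ->.
  have sI : s I = 0 by apply: sN => //; rewrite lt_neqAle lI (yV _ IV).1.
  by rewrite /x SE// sI max_r ?subrr ?eqxx// above_ge0.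
rewrite /load; under eq_bigr do rewrite big_distrr/=.
rewrite (exchange_big_dep xpredT)//=.
apply: eq_big_seq => J JV; rewrite -big_distrl/= sum_increments mulrC.
have [->|yJ] := eqVneq (y J) 0; first by rewrite !mul0r.
have {}yJ : 0 < y J by rewrite lt0r yJ y0.
by congr (_ * _); apply/le_anti; rewrite S_le// le_S.
Qed.
End finite_duality.

(** * Duality on an infinite tree *)

Lemma ler_sum_subset {T : eqType} {R : numDomainType} (f : T -> R) (s t : seq T) :
    uniq s -> uniq t -> {subset s <= t} -> (forall i, i \in t -> 0 <= f i) ->
  \sum_(i <- s) f i <= \sum_(i <- t) f i.
Proof.
move=> s_uniq t_uniq st f0.
have sE : perm_eq s [seq i <- t | i \in s].
  apply: uniq_perm => //; first exact: filter_uniq.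
  by move=> i; rewrite mem_filter; case: (boolP (i \in s)) => // /st ->.
rewrite (perm_big _ sE)/= big_filter [leRHS](bigID (mem s))/=.
rewrite lerDl big_seq_cond; apply: sumr_ge0 => i /andP[+ _]; exact: f0.
Qed.

Lemma sum_le_esum {T : choiceType} {R : realType} (D : set T) (f : T -> R)
    (s : seq T) (P : pred T) : uniq s -> (forall i, i \in s -> P i -> D i) ->
  ((\sum_(i <- s | P i) f i)%:E <= \esum_(i in D) (f i)%:E)%E.
Proof.
move=> s_uniq sD; apply: esum_ge; exists [set` [seq i <- s | P i]].
  split; first exact: finite_seq.
  by move=> i /=; rewrite mem_filter => /andP[Pi si]; exact: sD.
by rewrite -fsbig_seq ?filter_uniq// sumEFin big_filter.
Qed.

Lemma esum_le {T : choiceType} {R : realType} (D : set T) (f : T -> R) (C : \bar R) :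
    (forall s : seq T, uniq s -> (forall i, i \in s -> D i) ->
      ((\sum_(i <- s) f i)%:E <= C)%E) ->
  (\esum_(i in D) (f i)%:E <= C)%E.
Proof.
move=> sC; apply: ge_ereal_sup => _ [X [finX XD] <-].
rewrite fsbig_finite//= sumEFin; apply: sC => [|i].
  exact: fset_uniq.
by rewrite in_fset_set// inE => /XD.
Qed.

Lemma esum_seq {T : choiceType} {R : realType} (f : T -> R) (s : seq T)
    (P : pred T) : uniq s -> (forall i, i \in s -> P i -> 0 <= f i) ->
  \esum_(i in [set i | i \in s /\ P i]) (f i)%:E = (\sum_(i <- s | P i) f i)%:E.
Proof.
move=> s_uniq f0; rewrite (_ : mkset _ = [set` [seq i <- s | P i]]); last first.
  by apply/seteqP; split => i /=; rewrite mem_filter; [case=> -> ->|case/andP].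
rewrite esum_fset; first by rewrite -fsbig_seq ?filter_uniq// sumEFin big_filter.
- exact: finite_seq.
- by move=> i; rewrite inE/= mem_filter lee_fin => /andP[Pi si]; exact: f0.
Qed.

(** An ultrafilter [G] containing the image filter converges by compactness. The limit is already
    one along [U], because for each [A] the ultrafilter [U] contains the preimage of [A] or of its
    complement. *)
Lemma ultra_cvg_segment {T : Type} {R : realType} (U : set_system T)
    (f : T -> R) (a b : R) : UltraFilter U -> (forall t, a <= f t <= b) ->
  exists l : R, f x @[x --> U] --> l.
Proof.
move=> UU fab.
have UP : ProperFilter U by exact: ultra_proper.
have [G [GU fG]] := ultraFilterLemma (fmap_proper_filter f UP).
have : compact `[a, b] by exact: segment_compact.
rewrite compact_ultra => /(_ G GU)[|l [_ Gl]].
  by apply: fG; rewrite /fmap/=; apply: filterE => t; rewrite /= in_itv/=; exact: fab.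
exists l => A lA; have [//|nA] := in_ultra_setVsetC (f @^-1` A) UU.
have GA := Gl _ lA; have GnA : G (~` A) by apply: fG.
have GP : ProperFilter G by exact: ultra_proper.
have GAA : G (A `&` ~` A) by apply: filterI.
by have [x []] := filter_ex GAA.
Qed.

Section tree_duality.
Context {T : choiceType} {R : realType} (D : set T) (r : rel T).
Hypotheses (rxx : reflexive r) (rA : antisymmetric r) (rT : transitive r).
Hypothesis r_chain : forall J I I', r J I -> r J I' -> r I I' || r I' I.
(** A finite exhaustion of the tree. Each [F N] is closed upward, so the ancestor sums of its nodes
    over [D] are finite sums over [F N]. *)
Variable F : nat -> seq T.
Hypotheses (F_uniq : forall N, uniq (F N)) (FD : forall N I, I \in F N -> D I).
Hypothesis D_F : forall I, D I -> exists N, I \in F N.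
Hypothesis F_mono : forall N N', (N <= N')%N -> {subset F N <= F N'}.
Hypothesis F_up : forall N J I, J \in F N -> D I -> r J I -> I \in F N.
(** Here [v I] stands for [(|I| / |Q|)^beta], the weight in both objectives, and [k] for the
    normalising constant [|Q|^beta]. *)
Variables (u q v : T -> R) (k : R).
Hypotheses (k_gt0 : 0 < k) (u_gt0 : forall I, D I -> 0 < u I).
Hypotheses (q_gt0 : forall I, D I -> 0 < q I).
Hypothesis uqv : forall I, D I -> u I * q I = k * v I.

Definition covering : set (T -> R) :=
  [set lam | (forall I, D I -> 0 <= lam I) /\
    (forall J, D J -> (1 <= \esum_(I in [set I | D I /\ r J I])
                              (lam I * (u I / u J))%:E)%E)].

Definition packing : set (T -> R) :=
  [set mu | (forall J, D J -> 0 <= mu J) /\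
    (forall I, D I -> (\esum_(J in [set J | D J /\ r J I])
                          (mu J * (q J / q I))%:E <= 1)%E)].

Let v_gt0 I : D I -> 0 < v I.
Proof. by move=> DI; rewrite -(pmulr_rgt0 _ k_gt0) -uqv// mulr_gt0 ?u_gt0 ?q_gt0. Qed.

Let up_setE N J : J \in F N ->
  [set I | D I /\ r J I] = [set I | I \in F N /\ r J I].
Proof.
move=> JN; apply/seteqP; split => I /= [DI rJI]; split => //.
- exact: (F_up JN).
- exact: FD DI.
Qed.

Let seq_in_F (s : seq T) : (forall i, i \in s -> D i) ->
  exists N, {subset s <= F N}.
Proof.
elim: s => [_|a s IH sD]; first by exists 0%N.
have [N1 sN1] : exists N, {subset s <= F N}.
  by apply: IH => i si; apply: sD; rewrite inE si orbT.
have [N2 aN2] := D_F (sD a (mem_head _ _)).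
exists (maxn N1 N2) => i /[!inE] /predU1P[->|/sN1].
- exact: F_mono (leq_maxr _ _) _ aN2.
- exact: F_mono (leq_maxl _ _) _.
Qed.

Lemma weak_tree_duality lam mu : covering lam -> packing mu ->
  (\esum_(J in D) (mu J * v J)%:E <= \esum_(I in D) (lam I * v I)%:E)%E.
Proof.
move=> [lam0 lamC] [mu0 muC]; apply: esum_le => s s_uniq sD.
have [N sN] := seq_in_F sD.
apply: (@le_trans _ _ (\sum_(I <- F N) lam I * v I)%:E); last first.
  by apply: sum_le_esum => // I /FD.
rewrite lee_fin; apply: (@le_trans _ _ (\sum_(J <- F N) mu J * v J)).
  apply: ler_sum_subset => // J /FD DJ.
  by rewrite mulr_ge0 ?mu0// ltW// v_gt0.
rewrite -(ler_pM2l k_gt0) !big_distrr/=.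
have lamN J : J \in F N -> u J <= \sum_(I <- F N | r J I) lam I * u I.
  move=> JN; have uJ := u_gt0 (FD JN); have := lamC _ (FD JN).
  rewrite (up_setE JN) esum_seq//; last first.
    by move=> I /FD DI _; rewrite mulr_ge0 ?lam0// divr_ge0// ltW// u_gt0.
  rewrite lee_fin; under eq_bigr do rewrite mulrA.
  by rewrite -big_distrl/= ler_pdivlMr// mul1r.
have muN I : I \in F N -> \sum_(J <- F N | r J I) mu J * q J <= q I.
  move=> IN; have qI := q_gt0 (FD IN).
  have := le_trans (sum_le_esum (fun J => mu J * (q J / q I)) (F_uniq N)
    (fun J JN rJI => conj (FD JN) rJI)) (muC _ (FD IN)).
  rewrite lee_fin; under eq_bigr do rewrite mulrA.
  by rewrite -big_distrl/= ler_pdivrMr// mul1r.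
(* The middle term is the sum of [mu J * q J * lam I * u I] over the pairs with [I] above [J]; the
   covering bounds it below when [I] is summed first, the packing bounds it above when [J] is. *)
apply: (@le_trans _ _ (\sum_(J <- F N) mu J * q J *
                         \sum_(I <- F N | r J I) lam I * u I)).
  rewrite big_seq [leRHS]big_seq; apply: ler_sum => J JN; have DJ := FD JN.
  rewrite mulrCA -uqv// (mulrC (u J)) mulrA ler_wpM2l ?lamN//.
  by rewrite mulr_ge0 ?mu0// ltW// q_gt0.
under [leLHS]eq_bigr do rewrite big_distrr/=.
rewrite (exchange_big_dep xpredT)//= big_seq [leRHS]big_seq.
apply: ler_sum => I IN; have DI := FD IN.
rewrite -big_distrl/= [leRHS]mulrCA -uqv// mulrC mulrA ler_wpM2l ?muN//.
by rewrite mulr_ge0 ?lam0// ltW// u_gt0.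
Qed.

Let dual := ereal_sup [set (\esum_(J in D) (mu J * v J)%:E)%E | mu in packing].

(** Finite duality on [F N] with capacities [q] and weights [u] gives [x] and [y] of equal cost. The
    rescaled [y], extended by zero, is a packing of the whole tree, whence the bound by [dual]. *)
Lemma finite_covering N : exists lam : T -> R,
  [/\ forall I, 0 <= lam I, forall I, I \notin F N -> lam I = 0,
      forall J, J \in F N -> 1 <= \sum_(I <- F N | r J I) lam I * (u I / u J) &
      ((\sum_(I <- F N) lam I * v I)%:E <= dual)%E].
Proof.
have [x [y [[x0 y0] xu yq xy]]] := @finite_tree_duality T R r rxx rA rT r_chain
  (F N) q u (F_uniq N) (fun I IN => q_gt0 (FD IN)) (fun J JN => ltW (u_gt0 (FD JN))).
exists (fun I => if I \in F N then x I / u I else 0); split.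
- by move=> I; case: ifPn => // /FD DI; rewrite divr_ge0// ltW// u_gt0.
- by move=> I /negbTE ->.
- move=> J JN; have uJ := u_gt0 (FD JN).
  rewrite big_seq_cond (eq_bigr (fun I => x I / u J)); last first.
    move=> I /andP[IN _]; rewrite IN mulrA divfK//.
    by rewrite gt_eqF// u_gt0//; exact: FD IN.
  by rewrite -big_seq_cond -big_distrl/= ler_pdivlMr// mul1r xu.
pose mu J := if J \in F N then y J / q J else 0.
have mu0 J : 0 <= mu J.
  by rewrite /mu; case: ifPn => // /FD DJ; rewrite divr_ge0// ltW// q_gt0.
apply: (@le_trans _ _ (\esum_(J in D) (mu J * v J)%:E)); last first.
  apply: ereal_sup_ubound; exists mu => //; split => // I DI.
  have qI := q_gt0 DI.
  apply: esum_le => s s_uniq sD.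
  (* A node outside [F N] has no node of [F N] below it, by upward closure, so [mu] vanishes on its
     descendants. *)
  have [IN|nIN] := boolP (I \in F N); last first.
    rewrite big_seq big1 ?lee01// => J /sD[DJ rJI]; rewrite /mu ifN ?mul0r//.
    by apply: contra nIN => JN; exact: (F_up JN).
  rewrite lee_fin; under eq_bigr do rewrite mulrA.
  rewrite -big_distrl/= ler_pdivrMr// mul1r; apply: le_trans (yq _ IN).
  rewrite (bigID (mem (F N)))/= [X in _ + X]big1 ?addr0; last first.
    by move=> J /negbTE nJ; rewrite /mu nJ mul0r.
  rewrite (eq_bigr y); last first.
    by move=> J JN; rewrite /mu JN divfK// gt_eqF// q_gt0//; exact: FD JN.
  rewrite -big_filter -[leRHS]big_filter; apply: ler_sum_subset; rewrite ?filter_uniq//.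
  by move=> J; rewrite !mem_filter => /andP[-> /sD[_ ->]].
apply: le_trans (sum_le_esum (fun J => mu J * v J) (P := xpredT) (F_uniq N) _); last first.
  by move=> J /FD.
rewrite lee_fin -(ler_pM2l k_gt0) !big_distrr/=.
rewrite [leLHS](_ : _ = \sum_(I <- F N) x I * q I).
  rewrite xy le_eqVlt; apply/orP; left; apply/eqP.
  apply: eq_big_seq => J JN; have DJ := FD JN.
  by rewrite /mu JN mulrCA -uqv// (mulrC (u J)) mulrA divfK// gt_eqF// q_gt0.
apply: eq_big_seq => I IN; have DI := FD IN.
by rewrite IN mulrCA -uqv// mulrA divfK// gt_eqF// u_gt0.
Qed.

Lemma tree_duality :
  ereal_inf [set (\esum_(I in D) (lam I * v I)%:E)%E | lam in covering] = dual.
Proof.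
apply/eqP; rewrite eq_le; apply/andP; split; last first.
  apply: le_ereal_inf_tmp => _ [lam lamC <-]; apply: ge_ereal_sup => _ [mu muC <-].
  exact: weak_tree_duality.
have dual_ge0 : (0 <= dual)%E.
  have [lam [lam0 _ _]] := finite_covering 0; apply: le_trans.
  rewrite lee_fin big_seq sumr_ge0// => I /FD DI.
  by rewrite mulr_ge0// ltW// v_gt0.
have [->|dual_fin] := eqVneq dual +oo%E; first by rewrite leey.
have [c c0 dualE] : exists2 c, 0 <= c & dual = c%:E.
  by move: dual_ge0 dual_fin; case: dual => // c; exists c.
have /choice[lam lamP] := finite_covering.
(* [U] refines the filter of cofinal segments of the naturals: what holds for all large [N] holds
   along [U]. *)
have [U [UU oU]] := ultraFilterLemma (@eventually_filter).
have UP : ProperFilter U by exact: ultra_proper.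
have lam_le N s : uniq s -> (forall i, i \in s -> D i) ->
    \sum_(I <- s) lam N I * v I <= c.
  move=> s_uniq sD; have [l0 lN _] := lamP N.
  rewrite dualE lee_fin; apply: le_trans.
  rewrite (bigID (mem (F N)))/= [X in _ + X]big1 ?addr0; last first.
    by move=> J nJ; rewrite lN// mul0r.
  rewrite -big_filter; apply: ler_sum_subset; rewrite ?filter_uniq//.
  - by move=> I; rewrite mem_filter => /andP[].
  - by move=> I /FD DI; rewrite mulr_ge0// ltW// v_gt0.
(* A one-term sum in [lam_le] bounds [lam N I] by [c / v I] uniformly in [N]; outside [D] the values
   are 0. *)
have /choice[l lP] : forall I, exists l : R, lam N I @[N --> U] --> l.
  move=> I; have [DI|nDI] := pselect (D I); last first.
    apply: (@ultra_cvg_segment _ _ _ _ 0 0 UU) => N; have [_ lN _ _] := lamP N.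
    by rewrite lN ?lexx//; apply: contra_notN nDI => /FD.
  apply: (@ultra_cvg_segment _ _ _ _ 0 (c / v I) UU) => N.
  have [-> _ _ _] /= := lamP N; rewrite ler_pdivlMr ?v_gt0//.
  have := lam_le N [:: I] isT; rewrite big_seq1; apply => i.
  by rewrite inE => /eqP ->.
have sum_cvg (s : seq T) P (g : T -> R) :
    \sum_(I <- s | P I) lam N I * g I @[N --> U] --> \sum_(I <- s | P I) l I * g I.
  apply: cvg_big => [|I _]; first exact: add_continuous.
  by apply: cvgMl.
(* Fatou: each finite partial sum of the limit is a limit of sums bounded by [c]. *)
rewrite dualE; apply: (@le_trans _ _ (\esum_(I in D) (l I * v I)%:E)%E); last first.
  apply: esum_le => s s_uniq sD; rewrite lee_fin.
  by apply: (cvgr_to_le (sum_cvg s xpredT v)); apply: nearW => N; exact: lam_le.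
apply: ereal_inf_lbound; exists l => //; split => [I DI|J DJ].
  by apply: (cvgr_to_ge (lP I)); apply: nearW => N; have [] := lamP N.
have [N JN] := D_F DJ.
apply: le_trans (sum_le_esum _ (s := F N) (P := r J) (F_uniq N) _); last first.
  by move=> I /FD.
rewrite lee_fin; apply: (cvgr_to_ge (sum_cvg (F N) (r J) (fun I => u I / u J))).
(* For [M >= N] the nodes above [J] are the same in [F M] and [F N], so the constraint at [J] is one
   fixed finite sum, which passes to the limit. *)
apply: oU; exists N => // M /= NM; have JM := F_mono NM JN.
have [_ _ /(_ _ JM) h _] := lamP M; apply: (le_trans h).
have FMN : perm_eq [seq I <- F M | r J I] [seq I <- F N | r J I].
  apply: uniq_perm; rewrite ?filter_uniq// => I; rewrite !mem_filter.
  case: (boolP (r J I)) => //= rJI; apply/idP/idP => [/FD DI|].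
  - exact: F_up JN DI rJI.
  - exact: F_mono.
rewrite -[leLHS]big_filter (perm_big _ FMN)/= big_filter.
exact: lexx.
Qed.

End tree_duality.

(** * Volumes of boxes, cubes and their preimages *)

Lemma integral_scaled_itv {R : realType} (C c d : R) : 0 <= C -> c <= d ->
  (\int[lebesgue_measure]_t (C * \1_(`[c, d]%classic : set R) t)%:E =
   (C * (d - c))%:E)%E.
Proof.
move=> C0 cd; under eq_integral do rewrite EFinM.
rewrite ge0_integralZl_EFin//; last first.
  by apply/measurable_EFinP; exact: measurable_indic.
rewrite integral_indic// setIT EFinM; congr (_ * _)%E.
apply: etrans (lebesgue_measure_itv `[c, d]) _; rewrite /= lte_fin.
by move: cd; rewrite le_eqVlt => /predU1P[->|->]//; rewrite ltxx subrr.
Qed.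

Section box_cover.
Context {R : realType} {n : nat}.
Implicit Types (a b : 'rV[R]_n) (x : 'I_n -> R).

(* The indicator of [box a b] at [x] after integrating the variables below [j]. *)
Let partial_volume a b (j : nat) x :=
  \prod_(i < n) (if (i < j)%N then b 0 i - a 0 i
                 else \1_(`[a 0 i, b 0 i]%classic : set R) (x i)).

Let partial_volume_ge0 a b j x : (forall i, a 0 i <= b 0 i) ->
  0 <= partial_volume a b j x.
Proof.
by move=> ab; apply: prodr_ge0 => i _; case: ifP => _; rewrite ?subr_ge0.
Qed.

Let update x (j : 'I_n) (t : R) : 'I_n -> R := fun i => if i == j then t else x i.

Let cofactor a b (j : 'I_n) x :=
  \prod_(i < n | i != j) (if (i < j)%N then b 0 i - a 0 i
                          else \1_(`[a 0 i, b 0 i]%classic : set R) (x i)).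

Let partial_volume_update a b (j : 'I_n) x t :
  partial_volume a b j (update x j t) =
  cofactor a b j x * \1_(`[a 0 j, b 0 j]%classic : set R) t.
Proof.
rewrite /partial_volume (bigD1 j)//= ltnn /update eqxx mulrC.
by congr (_ * _); apply: eq_bigr => i /negbTE ->.
Qed.

Let measurable_partial_volume a b (j : 'I_n) x :
  measurable_fun setT (fun t => (partial_volume a b j (update x j t))%:E).
Proof.
under eq_fun do rewrite partial_volume_update.
apply/measurable_EFinP; apply: measurable_funM; first exact: measurable_cst.
exact: measurable_indic.
Qed.

Let integral_partial_volume a b (j : 'I_n) x : (forall i, a 0 i <= b 0 i) ->
  (\int[lebesgue_measure]_t (partial_volume a b j (update x j t))%:E =
   (partial_volume a b j.+1 x)%:E)%E.
Proof.
move=> ab; under eq_integral do rewrite partial_volume_update.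
rewrite integral_scaled_itv//; last first.
  by apply: prodr_ge0 => i _; case: ifP => _; rewrite ?subr_ge0.
rewrite /partial_volume [in RHS](bigD1 j)//= ltnSn mulrC.
congr (_ * _)%:E; apply: eq_bigr => i /negbTE ij.
by rewrite ltnS [in RHS]leq_eqVlt -[(_ == _ :> nat)]/(i == j) ij.
Qed.

(** The indicator of the box is at most the sum of the indicators of the covering boxes. Integrating
    this inequality in one variable at a time, and exchanging integral and series, turns every
    indicator into a volume. *)
Lemma box_volume_le_cover a b (c d : nat -> 'rV[R]_n) :
    (forall i, a 0 i <= b 0 i) -> (forall k i, c k 0 i <= d k 0 i) ->
    box a b `<=` \bigcup_k box (c k) (d k) ->
  ((\prod_i (b 0 i - a 0 i))%:E <=
    \sum_(0 <= k <oo) (\prod_i (d k 0 i - c k 0 i))%:E)%E.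
Proof.
move=> ab cd cover.
suff H j : (j <= n)%N -> forall x, ((partial_volume a b j x)%:E <=
    \sum_(0 <= k <oo) (partial_volume (c k) (d k) j x)%:E)%E.
  (* Once all variables are integrated nothing depends on the point, so any point serves. *)
  have := H n (leqnn n) (fun=> 0); rewrite /partial_volume.
  by under [X in X%:E]eq_bigr do rewrite ltn_ord; under [X in (_ <= X)%E]eq_eseriesr
    do under eq_bigr do rewrite ltn_ord.
elim: j => [_ x|j IH jn x]; last first.
  pose J := Ordinal jn.
  rewrite -[j.+1]/(J : nat).+1 -integral_partial_volume//.
  under eq_eseriesr do rewrite -integral_partial_volume//.
  rewrite -integral_nneseries//; last first.
  - by move=> k t _; rewrite lee_fin partial_volume_ge0.
  - by move=> k; exact: measurable_partial_volume.
  apply: ge0_le_integral => //.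
  - by move=> t _; rewrite lee_fin partial_volume_ge0.
  - exact: measurable_partial_volume.
  - apply: (@ge0_emeasurable_sum _ _ _ _ _ xpredT) => [k t _ _|k _].
    + by rewrite lee_fin partial_volume_ge0.
    + exact: measurable_partial_volume.
  - by move=> t _; apply: IH; exact: ltnW.
have pv0 a' b' : partial_volume a' b' 0%N x = \1_(box a' b') (\row_i x i).
  rewrite /partial_volume indicE.
  have [/set_mem xB|xB] := boolP (_ \in box a' b').
    rewrite big1// => i _; rewrite indicE mem_set//= in_itv/=.
    by have := xB i; rewrite mxE.
  have [i xi] : exists i, ~ a' 0 i <= x i <= b' 0 i.
    apply/existsNP => xB'; move/negP: xB; apply; apply/mem_set => i.
    by rewrite mxE.
  by rewrite (bigD1 i)//= indicE memNset ?mul0r//= in_itv/=.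
rewrite pv0; under eq_eseriesr do rewrite pv0.
have [xab|xab] := boolP ((\row_i x i) \in box a b); last first.
  by rewrite indicE (negbTE xab); apply: nneseries_ge0 => k _ _; rewrite lee_fin.
have [k _ xk] := cover _ (set_mem xab).
rewrite (@nneseriesD1 _ _ k)//.
by rewrite !indicE xab mem_set//= leeDl//; apply: nneseries_ge0 => i _ _; rewrite lee_fin.
Qed.

End box_cover.

Section volume.
Context {R : realType} {n : nat}.
Implicit Types (A B : set 'rV[R]_n) (a b : 'rV[R]_n) (Q : cube R n).

Lemma box_volume_le_lebesgue_rV A a b : (forall i, a 0 i <= b 0 i) ->
  box a b `<=` A -> ((\prod_i (b 0 i - a 0 i))%:E <= lebesgue_rV A)%E.
Proof.
move=> ab abA; apply: le_ereal_inf_tmp => _ [c [d [cd Acd ->]]].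
by apply: box_volume_le_cover => //; exact: subset_trans Acd.
Qed.

Hypothesis n_gt0 : (0 < n)%N.

Lemma lebesgue_rV_le_box_volume A a b : (forall i, a 0 i <= b 0 i) ->
  A `<=` box a b -> (lebesgue_rV A <= (\prod_i (b 0 i - a 0 i))%:E)%E.
Proof.
move=> ab Aab; apply: ereal_inf_lbound.
(* The cover is the box itself followed by degenerate boxes, of volume 0 because [n > 0] provides a
   zero factor. *)
exists (fun k => if k == 0%N then a else 0), (fun k => if k == 0%N then b else 0); split.
- by move=> [|k] i.
- by move=> x Ax; exists 0%N => //; exact: Aab.
rewrite (@nneseriesD1 _ _ 0%N)//; last first.
  move=> k _; rewrite lee_fin; apply: prodr_ge0 => i _; rewrite subr_ge0.
  by case: k.
rewrite eseries0 ?adde0// => k _ /=; case: k => // k _.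
by rewrite (bigD1 (Ordinal n_gt0))//= subrr mul0r.
Qed.

Lemma nbhs_box_sub A (x : 'rV[R]_n) : nbhs x A -> exists a b,
  (forall i, a 0 i < b 0 i) /\ box a b `<=` A.
Proof.
move=> /nbhs_ballP[e /= e0 eA]; exists (x - const_mx (e / 2)), (x + const_mx (e / 2)).
split=> [i|y xy]; first by rewrite !mxE; lra.
apply: eA; split => // i j; rewrite ord1.
by have := xy j; rewrite !mxE /ball/= ltr_norml; lra.
Qed.

Lemma bounded_sub_box A : bounded_set A -> exists a b,
  (forall i, a 0 i <= b 0 i) /\ A `<=` box a b.
Proof.
move=> [M [_ /(_ (`|M| + 1))]].
rewrite (le_lt_trans (ler_norm M)) ?ltrDl// => /(_ isT) AM.
exists (const_mx (- (`|M| + 1))), (const_mx (`|M| + 1)); split=> [i|x /AM xM i].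
  by rewrite !mxE; have := normr_ge0 M; lra.
rewrite !mxE -ler_norml; apply: le_trans xM.
rewrite [leRHS]/Num.Def.normr /= mx_normrE; apply/bigmax_geP; right => /=.
by exists (0, i).
Qed.

Lemma bounded_set_sub A B : A `<=` B -> bounded_set B -> bounded_set A.
Proof. by move=> AB [M [Mr BM]]; exists M; split=> // y /BM By x /AB; exact: By. Qed.

(** An inner box makes the measure positive, and an outer box makes it finite, so that [fine] does
    not send it to 0. *)
Lemma vol_gt0 A (x : 'rV[R]_n) : bounded_set A -> nbhs x A -> 0 < vol A.
Proof.
move=> /bounded_sub_box[a [b [ab Aab]]] /nbhs_box_sub[c [d [cd cdA]]].
rewrite fine_gt0//; apply/andP; split.
  apply: lt_le_trans (box_volume_le_lebesgue_rV _ cdA) => [|i]; last exact: ltW.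
  by rewrite lte_fin; apply: prodr_gt0 => i _; rewrite subr_gt0.
exact: le_lt_trans (lebesgue_rV_le_box_volume ab Aab) (ltry _).
Qed.

Definition cube_center Q : 'rV[R]_n := corner Q + const_mx (side Q / 2).

Lemma ball_center_sub Q : ball (cube_center Q) (side Q / 2) `<=` Q.
Proof.
move=> y [_ Qy] i; have := Qy 0 i; have := side_gt0 Q.
rewrite in_itv/= /ball/= !mxE ltr_norml => s0 /andP[y1 y2].
by case: lower_closed; case: upper_closed => /=; apply/andP; split; lra.
Qed.

Lemma nbhs_cube_center Q : nbhs (cube_center Q) Q.
Proof.
apply/nbhs_ballP; exists (side Q / 2); last exact: ball_center_sub.
by rewrite /= divr_gt0// side_gt0.
Qed.

Lemma cube_sub_box Q :
  Q `<=` box (corner Q) (corner Q + const_mx (side Q)).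
Proof.
move=> y Qy i; have := Qy i; rewrite in_itv/= !mxE.
case: lower_closed; case: upper_closed => /= /andP[? ?]; apply/andP;
  by split=> //; apply: ltW.
Qed.

Lemma compact_box a b : compact (box a b).
Proof.
rewrite (_ : box a b = [set x | forall i, `[a 0 i, b 0 i]%classic (x ord0 i)]).
  apply: (@rV_compact _ _ (fun i => `[a 0 i, b 0 i]%classic)) => i.
  exact: segment_compact.
by apply/seteqP; split => x xab i; have := xab i; rewrite /= in_itv.
Qed.

Lemma cube_vol_gt0 Q : 0 < vol Q.
Proof.
apply: vol_gt0 (nbhs_cube_center Q); apply: (bounded_set_sub (@cube_sub_box Q)).
exact/(@compact_bounded R 'rV[R]_n)/compact_box.
Qed.

(** Continuity of [phi] makes the preimage a neighbourhood of the point over the centre of [Q];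
    continuity of the inverse [g] bounds it, since it lies in the image under [g] of a compact
    box. *)
Lemma preimage_cube_vol_gt0 (phi : 'rV[R]_n -> 'rV[R]_n) Q :
  homeomorphism phi -> 0 < vol (phi @^-1` Q).
Proof.
move=> [g [phiK gK phi_cont g_cont]].
apply: (@vol_gt0 _ (g (cube_center Q))); last first.
  by apply: phi_cont; rewrite gK; exact: nbhs_cube_center.
have cK : compact (g @` box (corner Q) (corner Q + const_mx (side Q))).
  apply: continuous_compact; last exact: compact_box.
  exact: continuous_subspaceT.
apply: (bounded_set_sub _ (compact_bounded cK)).
by move=> x /cube_sub_box Qx; exists (phi x).
Qed.

End volume.

(** * The tree of dyadic cubes *)

Section dyadic_cubes.
Context {R : realType} {n : nat}.
Implicit Types (Q I J : cube R n).

Lemma eq_cube I J : corner I = corner J -> side I = side J ->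
  lower_closed I = lower_closed J -> upper_closed I = upper_closed J -> I = J.
Proof.
case: I J => [c s l u s0] [c' s' l' u' s'0] /= cc ss ll uu.
by subst; congr Cube; exact: bool_irrelevance.
Qed.

Lemma subcube_sub I e : subcube I e `<=` I.
Proof.
move=> x xI i; have := xI i; have := side_gt0 I.
rewrite !in_itv/= !mxE => s0.
case: (e i); case: lower_closed; case: upper_closed => /= /andP[? ?];
  by apply/andP; split; lra.
Qed.

Lemma dyadic_gen_grid k Q I : dyadic_gen k Q I ->
  [/\ side I = side Q / 2 ^+ k, lower_closed I = lower_closed Q,
      upper_closed I = upper_closed Q &
      exists z : 'I_n -> nat, forall i, corner I 0 i = corner Q 0 i + side I * (z i)%:R].
Proof.
elim: k I => [I ->|k IH _ [I /IH[sI lI uI [z zI]] [e _ <-]]] /=.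
  by split; rewrite ?expr0 ?divr1//; exists (fun=> 0%N) => i; rewrite mulr0 addr0.
split=> //; first by rewrite sI exprSr invfM mulrA.
(* Halving the mesh doubles the grid coordinate, and the choice of the upper half adds one. *)
exists (fun i => (z i).*2 + e i)%N => i.
by rewrite !mxE zI natrD -muln2 natrM; lra.
Qed.

Lemma dyadic_gen_ancestor k l Q J : dyadic_gen l Q J -> (k <= l)%N ->
  exists2 I, dyadic_gen k Q I & J `<=` I.
Proof.
elim: l J => [J QJ|l IH J QJ]; first by rewrite leqn0 => /eqP ->; exists J.
rewrite leq_eqVlt => /predU1P[->|kl]; first by exists J.
case: QJ => I QI [e _ <-]; have [I' QI' II'] := IH _ QI kl.
by exists I' => //; apply: subset_trans II'; exact: subcube_sub.
Qed.

(** The centre of [J] moved by [e] up or down along the diagonal stays in [J], hence in [I].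
    Strictness of [e < side J / 2] keeps these points interior, whatever endpoints [J] includes. *)
Lemma subset_cube_bounds J I (e : R) i : J `<=` I -> 0 <= e < side J / 2 ->
  corner I 0 i + e <= cube_center J 0 i <= corner I 0 i + side I - e.
Proof.
move=> JI /andP[e0 eJ]; have sJ := side_gt0 J.
have in_I t : `|t| < side J / 2 ->
    corner I 0 i <= cube_center J 0 i + t <= corner I 0 i + side I.
  move=> te; have /JI/(_ i) : (J : set 'rV[R]_n) (cube_center J + const_mx t).
    apply: ball_center_sub; split; first by rewrite divr_gt0.
    by move=> j k; rewrite /ball/= !mxE opprD addrA subrr sub0r normrN.
  rewrite in_itv/= !mxE.
  by case: lower_closed; case: upper_closed => /= /andP[? ?]; apply/andP; split; lra.
have := in_I e; have := in_I (- e); rewrite normrN ger0_norm// => /(_ eJ) + /(_ eJ).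
by lra.
Qed.

Hypothesis n_gt0 : (0 < n)%N.

Lemma subset_cube_side J I : J `<=` I -> side J <= side I.
Proof.
move=> JI; rewrite leNgt; apply/negP => IJ; have sI := side_gt0 I.
(* The midpoint of the two half-sides: less than half of [side J], yet too large a margin to fit
   twice in [side I]. *)
have eJ : 0 <= (side I + side J) / 4 < side J / 2 by lra.
by have := subset_cube_bounds (Ordinal n_gt0) JI eJ; lra.
Qed.

(** Both cubes lie on the same grid and contain the centre of [J] with a positive margin in every
    coordinate, so their integer coordinates differ by less than 1. *)
Lemma dyadic_gen_eq k Q I I' J : dyadic_gen k Q I -> dyadic_gen k Q I' ->
  J `<=` I -> J `<=` I' -> I = I'.
Proof.
move=> /dyadic_gen_grid[sI lI uI [z zI]] /dyadic_gen_grid[sI' lI' uI' [z' zI']] JI JI'.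
have ss : side I = side I' by rewrite sI sI'.
apply: eq_cube; rewrite ?lI ?uI//; apply/rowP => i; rewrite zI zI' ss.
suff -> : z i = z' i by [].
have sJ := side_gt0 J; have s0 := side_gt0 I'.
have eJ : 0 <= side J / 4 < side J / 2 by lra.
have := subset_cube_bounds i JI eJ; have := subset_cube_bounds i JI' eJ.
rewrite zI zI' ss => h h'.
have lt_nat (a b : nat) : side I' * a%:R < side I' * b%:R + side I' -> (a <= b)%N.
  by rewrite -[X in _ + X]mulr1 -mulrDr ltr_pM2l// natr1 ltr_nat ltnS.
by apply/eqP; rewrite eqn_leq !lt_nat//; lra.
Qed.

Lemma dyadic_gen_le k l Q I J : dyadic_gen k Q I -> dyadic_gen l Q J ->
  J `<=` I -> (k <= l)%N.
Proof.
move=> /dyadic_gen_grid[sI _ _ _] /dyadic_gen_grid[sJ _ _ _] /subset_cube_side.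
rewrite sI sJ ler_pM2l ?side_gt0// lef_pV2 ?posrE ?exprn_gt0//.
by rewrite ler_eXn2l// ltr1n.
Qed.

(** The ancestor of the finer cube in the generation of the coarser one also contains [J], so it is
    the coarser cube. *)
Lemma dyadic_chain Q I I' J : dyadic Q I -> dyadic Q I' -> J `<=` I -> J `<=` I' ->
  I `<=` I' \/ I' `<=` I.
Proof.
move=> [k _ QI] [k' _ QI'] JI JI'; wlog kk' : k k' I I' QI QI' JI JI' / (k <= k')%N.
  move=> H; have [kk'|/ltnW k'k] := leqP k k'; first exact: (H k k').
  by have [] := H k' k I' I QI' QI JI' JI k'k; [right|left].
right; have [I2 QI2 I'I2] := dyadic_gen_ancestor QI' kk'.
by rewrite (dyadic_gen_eq QI QI2 JI (subset_trans JI' I'I2)).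
Qed.

Lemma dyadic_sub_anti Q I J : dyadic Q I -> dyadic Q J ->
  I `<=` J -> J `<=` I -> I = J.
Proof.
move=> [k _ QI] [l _ QJ] IJ JI.
have kl : k = l.
  by apply/eqP; rewrite eqn_leq (dyadic_gen_le QI QJ JI) (dyadic_gen_le QJ QI IJ).
by move: QJ; rewrite -kl => QJ; exact: (dyadic_gen_eq QI QJ (@subset_refl _ I) IJ).
Qed.

Lemma finite_dyadic_gen k Q : finite_set (dyadic_gen k Q).
Proof.
elim: k => [|k IH]; first exact: finite_set1.
apply: bigcup_finite => // I _.
apply: (@sub_finite_set _ _ ((fun e : {ffun 'I_n -> bool} => subcube I e) @` setT)).
  move=> _ [e _ <-]; exists (finfun e) => //; congr subcube.
  by apply/funext => i; rewrite ffunE.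
by apply: finite_image; exact: finite_finset.
Qed.

Definition dyadic_upto Q N : set (cube R n) := \bigcup_(k < N.+1) dyadic_gen k Q.

Lemma finite_dyadic_upto Q N : finite_set (dyadic_upto Q N).
Proof. by apply: bigcup_finite => [|k _]; [exact: finite_II|exact: finite_dyadic_gen]. Qed.

(* Inclusion is antisymmetric, and the cubes above a given one form a chain,
   only within [dyadic Q]: elsewhere we use equality. *)
Definition dyadic_le Q : rel (cube R n) :=
  fun J I => `[< J = I \/ [/\ dyadic Q J, dyadic Q I & J `<=` I] >].

Lemma dyadic_leE Q J I : dyadic Q J -> dyadic Q I ->
  dyadic_le Q J I = (J `<=` I) :> Prop.
Proof.
move=> QJ QI; apply/propext; split=> [/asboolP[->//|[]//]|JI].
by apply/asboolP; right.
Qed.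

Lemma dyadic_le_refl Q : reflexive (dyadic_le Q).
Proof. by move=> I; apply/asboolP; left. Qed.

Lemma dyadic_le_anti Q : antisymmetric (dyadic_le Q).
Proof.
move=> I J /andP[/asboolP[//|[QI QJ IJ]] /asboolP[//|[_ _ JI]]].
exact: (dyadic_sub_anti QI QJ IJ JI).
Qed.

Lemma dyadic_le_trans Q : transitive (dyadic_le Q).
Proof.
move=> I J K /asboolP[->//|[QJ QI JI]] /asboolP[<-|[_ QK IK]]; apply/asboolP; right => //.
by split=> //; exact: subset_trans IK.
Qed.

Lemma dyadic_le_chain Q J I I' : dyadic_le Q J I -> dyadic_le Q J I' ->
  dyadic_le Q I I' || dyadic_le Q I' I.
Proof.
move=> /[dup] rJI /asboolP[<- ->//|[QJ QI JI]] /asboolP[<-|[_ QI' JI']].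
  by rewrite rJI orbT.
have [II'|I'I] := dyadic_chain QI QI' JI JI'.
- by apply/orP; left; apply/asboolP; right.
- by apply/orP; right; apply/asboolP; right.
Qed.

End dyadic_cubes.

(** * Reduction to duality on the tree of dyadic cubes *)

Theorem theorem3p1 (R : realType) (n : nat) (n_gt0 : (0 < n)%N) (beta : R)
    (phi : 'rV[R]_n -> 'rV[R]_n) (phi_homeo : homeomorphism phi)
    (Q : cube R n) :
  G_norm phi beta Q =
  ereal_sup [set (\esum_(J in dyadic Q)
                    (mu J * (vol J / vol Q) `^ beta)%:E)%E
            | mu in Tstar_family phi beta Q].
Proof.
have vol0 (I : cube R n) : 0 < vol I by exact: cube_vol_gt0.
have pvol0 (I : cube R n) : 0 < vol (phi @^-1` I) by exact: preimage_cube_vol_gt0.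
pose u (I : cube R n) := (vol I / vol (phi @^-1` I)) `^ beta.
pose q (I : cube R n) := vol (phi @^-1` I) `^ beta.
have u0 I : 0 < u I by rewrite powR_gt0 ?divr_gt0.
have q0 I : 0 < q I by rewrite powR_gt0.
have up_setE (J : cube R n) : dyadic Q J ->
    [set I : cube R n | dyadic Q I /\ J `<=` I] =
    [set I | dyadic Q I /\ dyadic_le Q J I].
  move=> QJ; apply/seteqP; split => I /= [QI JI]; split => //;
    by move: JI; rewrite dyadic_leE.
have down_setE (I : cube R n) : dyadic Q I ->
    [set J : cube R n | dyadic Q J /\ J `<=` I] =
    [set J | dyadic Q J /\ dyadic_le Q J I].
  move=> QI; apply/seteqP; split => J /= [QJ JI]; split => //;
    by move: JI; rewrite dyadic_leE.
have uE (I J : cube R n) :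
    ((vol I / vol J) * (vol (phi @^-1` J) / vol (phi @^-1` I))) `^ beta = u I / u J.
  apply: (canRL (mulfK _)); first by rewrite gt_eqF.
  rewrite /u -powRM; last 2 first.
  - by rewrite ltW// mulr_gt0// divr_gt0.
  - by rewrite ltW// divr_gt0.
  by congr (_ `^ _); field; rewrite !gt_eqF.
have qE (I J : cube R n) :
    (vol (phi @^-1` J) / vol (phi @^-1` I)) `^ beta = q J / q I.
  apply: (canRL (mulfK _)); first by rewrite gt_eqF.
  rewrite /q -powRM ?divfK ?gt_eqF//; first by rewrite ltW// divr_gt0.
  exact: ltW.
(* The ratios in the two families of constraints factor through [u] and [q], which identifies them
   with coverings and packings of the tree. *)
have TE : T_family phi beta Q = covering (dyadic Q) (dyadic_le Q) u.
  apply/seteqP; split => lam /= [lam0 lamJ]; split => // J QJ;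
    have := lamJ _ QJ; rewrite up_setE//.
  - by under eq_esum do rewrite uE.
  - by under [in X in _ -> X]eq_esum do rewrite uE.
have TstarE : Tstar_family phi beta Q = packing (dyadic Q) (dyadic_le Q) q.
  apply/seteqP; split => mu /= [mu0 muI]; split => // I QI;
    have := muI _ QI; rewrite down_setE//.
  - by under eq_esum do rewrite qE.
  - by under [in X in _ -> X]eq_esum do rewrite qE.
pose F N : seq (cube R n) := fset_set (dyadic_upto Q N).
have FE N I : I \in F N <-> dyadic_upto Q N I.
  by rewrite in_fset_set ?inE//; exact: finite_dyadic_upto.
have QF I : dyadic Q I -> exists N, I \in F N.
  by move=> [k _ QI]; exists k; apply/FE; exists k => //=.
have FQ N I : I \in F N -> dyadic Q I by move=> /FE[k _ QI]; exists k.
rewrite /G_norm TE TstarE.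
apply: (@tree_duality _ _ _ _ (dyadic_le_refl Q) (dyadic_le_anti n_gt0 (Q := Q))
  (@dyadic_le_trans _ _ Q) (@dyadic_le_chain _ _ Q) F _ FQ QF _ _
  u q (fun I => (vol I / vol Q) `^ beta) (vol Q `^ beta)) => //.
- by move=> N; exact: fset_uniq.
- move=> N N' NN' I /FE[k /= kN QI]; apply/FE; exists k => //=.
  by rewrite ltnS in kN *; exact: leq_trans NN'.
(* Upward closure: a dyadic cube containing [J] has generation at most that of [J]. *)
- move=> N J I JN DI; rewrite dyadic_leE//; last exact: FQ JN.
  move: JN DI => /FE[l /= lN QJ] [k _ QI] JI; apply/FE; exists k => //=.
  exact: leq_ltn_trans (dyadic_gen_le n_gt0 QI QJ JI) lN.
- by rewrite powR_gt0.
(* Both sides equal [|I|^beta]. *)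
- move=> I _; rewrite /u /q -!powRM ?divr_ge0 ?ltW//.
  by congr (_ `^ _); field; rewrite !gt_eqF.
Qed.
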